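(* Let $b\ge 2$ and $n\ge 2$ be integers, and let $P_n$ be the point process of carries (equivalently, descents) on $\{1,\dots,n-1\}$ associated with $n$ independent uniformly random base-$b$ digits. Then $P_n$ is determinantal with correlation kernel $K(i,j)=k(j-i)$, $1\le i,j\le n-1$, where the numbers $k(m)$ are given by the Laurent expansion at $t=0$ $$\sum_{m\in\mathbb{Z}}k(m)t^m=\frac{1}{1-(1-t)^b}.$$
   Context: Let $\mathcal{B}=\{0,1,\dots,b-1\}$. Carries: if $A_1,\dots,A_n\in\mathcal{B}$ are independent uniform digits added one after another, put $B_i=A_1+\cdots+A_i \bmod b\in\mathcal{B}$ (the remainders); there is a carry at $i$ ($1\le i\le n-1$) if $B_i+A_{i+1}\ge b$. This occurs if and only if $B_i>B_{i+1}$, i.e. the remainder sequence has a descent at $i$; and $B_1,\dots,B_n$ are again independent and uniform on $\mathcal{B}$. Thus $P_n$ is the law of the random set $\{i\in\{1,\dots,n-1\}:B_i>B_{i+1}\}$ for $B_1,\dots,B_n$ independent uniform on $\mathcal{B}$. A point process $P$ on a finite set $\mathcal{X}$ (a probability measure on subsets of $\mathcal{X}$) is determinantal with (correlation) kernel $K(x,y)$ if $P\{S:S\supseteq A\}=\det(K(x,y))_{x,y\in A}$ for every $A\subseteq\mathcal{X}$. *)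

(* Defs.v *)
From mathcomp Require Import all_boot all_order all_algebra.

Set Implicit Arguments.
Unset Strict Implicit.
Unset Printing Implicit Defensive.

Import Order.TTheory GRing.Theory Num.Theory.
Local Open Scope ring_scope.

Notation "x %:F" := (FracField.tofrac x)
  (format "x %:F") : ring_scope.

(* A measure on the subsets of X is given by its mass function. *)

Definition is_point_process (R : realFieldType) (X : finType)
    (P : {set X} -> R) : Prop :=
  (forall S, 0 <= P S) /\ \sum_S P S = 1.

Definition determinantal (R : realFieldType) (X : finType)
    (P : {set X} -> R) (K : X -> X -> R) : Prop :=
  is_point_process P /\
  forall A : {set X},
    \sum_(S : {set X} | A \subset S) P S =
    \det (\matrix_(i < #|A|, j < #|A|) K (enum_val i) (enum_val j)).

(* Indices are 0-based: the digits A_1, ..., A_n are a 0, ..., a (n - 1), and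
   the sites 1, ..., n - 1 are the elements 0, ..., n - 2 of 'I_n.-1. The site
   i involves the digits of ranks i and i + 1, that is [site i], [succ_site i]. *)

Definition digits (b n : nat) : finType := {ffun 'I_n -> 'I_b}.

Definition site (n : nat) (i : 'I_n.-1) : 'I_n := widen_ord (leq_pred n) i.

Definition succ_site (n : nat) (i : 'I_n.-1) : 'I_n :=
  Ordinal (etrans (esym (ltn_predRL i n)) (ltn_ord i)).

Definition remainder (b n : nat) (a : digits b n) (i : 'I_n) : nat :=
  ((\sum_(j < n | j <= i) a j) %% b)%N.

Definition carries (b n : nat) (a : digits b n) : {set 'I_n.-1} :=
  [set i : 'I_n.-1 | (b <= remainder a (site i) + a (succ_site i))%N].

(* Applied to the remainders themselves, which are again independent uniform
   digits. *)
Definition descents (b n : nat) (a : digits b n) : {set 'I_n.-1} :=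
  [set i : 'I_n.-1 | (a (succ_site i) < a (site i))%N].

(* The law of F (A_1, ..., A_n) for independent uniform digits A_i: the joint
   mass function is the product of n uniform mass functions. *)
Definition law_of_digits (R : realFieldType) (b n : nat) (X : finType)
    (F : digits b n -> {set X}) (S : {set X}) : R :=
  \sum_(a : digits b n | F a == S) \prod_(i < n) (b%:R)^-1.

Definition carry_process (R : realFieldType) (b n : nat) :
    {set 'I_n.-1} -> R :=
  law_of_digits R (@carries b n).

Definition descent_process (R : realFieldType) (b n : nat) :
    {set 'I_n.-1} -> R :=
  law_of_digits R (@descents b n).

Arguments carry_process R b n : clear implicits.
Arguments descent_process R b n : clear implicits.

(* A formal Laurent series is its coefficient function int -> R, vanishing
   below some index. *)

Definition finite_principal_part (R : fieldType) (k : int -> R) : Prop :=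
  exists N : int, forall m : int, m < N -> k m = 0.

Definition poly_series (R : fieldType) (p : {poly R}) (m : int) : R :=
  if m is Posz i then p`_i else 0.

Definition mul_poly_series (R : fieldType) (q : {poly R}) (k : int -> R)
    (m : int) : R :=
  \sum_(i < size q) q`_i * k (m - i%:Z).

(* k is the image of the rational function f under the embedding of fields
   R(t) -> R((t)): if f = p / q then q * k = p in R((t)). *)
Definition laurent_expansion (R : fieldType) (f : {fraction {poly R}})
    (k : int -> R) : Prop :=
  finite_principal_part k /\
  forall p q : {poly R}, q != 0 -> f = p%:F / q%:F ->
    forall m : int, mul_poly_series q k m = poly_series p m.

(* Main.v *)
Require Import Defs.
From mathcomp Require Import all_boot all_order all_algebra.
From mathcomp Require Import zify ring.

(** Taking remainders is a bijection of digit sequences that turns carries into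
descents, so it suffices to treat descents. Fix a set A of sites. Since
k(m) = 0 for m < -1, the matrix K restricted to A is Hessenberg, and its
subdiagonal entry at consecutive sites x < y of A is 1/b if y = x + 1 and 0
otherwise. Expanding the determinant along its first column, again and again,
one obtains the first row combined with the trailing minors; the expansion
stops at the end of the first run of consecutive sites of A. On the other side,
the probability that A consists of descents is a product over the runs of A,
a run of length r contributing C(b, r+1) / b^(r+1). Both sides agree because
the coefficient of t^r in the product of 1 - (1 - t)^b with the sum of the
k(m) t^m is 0 for r >= 1. *)

Set Implicit Arguments.
Unset Strict Implicit.
Unset Printing Implicit Defensive.

Import Order.TTheory GRing.Theory Num.Theory.
Local Open Scope ring_scope.

(** * Hockey-stick identity and expansion of Hessenberg determinants *)

Lemma sum_bin (r x : nat) : (\sum_(y < x) 'C(y, r))%N = 'C(x, r.+1).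
Proof.
elim: x => [|x IHx]; first by rewrite big_ord0 bin0n.
by rewrite big_ord_recr /= IHx binS addnC.
Qed.

(* The kernel matrix of the sites s, with its first row replaced by g: the family
   of determinants stable under expansion along the first column. *)
Definition bordered_det (R : comNzRingType) (K : nat -> nat -> R) (g : nat -> R)
    (s : seq nat) : R :=
  \det (\matrix_(i < size s, j < size s)
    if val i is 0 then g (nth 0%N s j) else K (nth 0%N s i) (nth 0%N s j)).

Definition kernel_det (R : comNzRingType) (K : nat -> nat -> R) (s : seq nat) : R :=
  \det (\matrix_(i < size s, j < size s) K (nth 0%N s i) (nth 0%N s j)).

Lemma eq_bordered_det (R : comNzRingType) (K : nat -> nat -> R) g g' s :
  g =1 g' -> bordered_det K g s = bordered_det K g' s.
Proof.
by move=> E; congr (\det _); apply/matrixP => -[[|i] Hi] j; rewrite !mxE /= ?E.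
Qed.

Lemma bordered_det1 (R : comNzRingType) (K : nat -> nat -> R) g x :
  bordered_det K g [:: x] = g x.
Proof. by rewrite /bordered_det det_mx11 mxE /=. Qed.

(** Below its second row the first column vanishes, so two cofactors remain: deleting the first row
    leaves [K y] on top, deleting the second leaves [g]. *)
Lemma bordered_det_cons (R : comNzRingType) (K : nat -> nat -> R) g x y s :
  (forall z, z \in s -> K z x = 0) ->
  bordered_det K g [:: x, y & s] =
  g x * bordered_det K (K y) (y :: s) - K y x * bordered_det K g (y :: s).
Proof.
move=> Kx0; rewrite /bordered_det (expand_det_col _ ord0) /=.
rewrite big_ord_recl big_ord_recl big1 => [|i _]; last first.
  by rewrite mxE /= [K _ _](Kx0 _ (mem_nth 0%N (ltn_ord i))) mul0r.
rewrite addr0 !mxE /= /cofactor /= expr0 mul1r expr1 mulN1r mulrN.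
congr (_ * _ - _ * _); congr (\det _); apply/matrixP => i j; rewrite !mxE /=.
  by case: i => -[|i] Hi.
by case: i => -[|i] Hi.
Qed.

Lemma bordered_det_kernel (R : comNzRingType) (K : nat -> nat -> R) x s :
  bordered_det K (K x) (x :: s) = kernel_det K (x :: s).
Proof. by congr (\det _); apply/matrixP => -[[|i] Hi] j; rewrite !mxE. Qed.

(* The number of digit sequences starting at x whose successive steps descend
   wherever w is true; the other steps are unconstrained. *)
Fixpoint chains (b : nat) (w : seq bool) (x : nat) : nat :=
  if w is d :: w' then (\sum_(y < if d then x else b) chains b w' y)%N
  else 1.

Definition pattern_prob (R : fieldType) (b : nat) (w : seq bool) : R :=
  (\sum_(x < b) chains b w x)%:R / b%:R ^+ (size w).+1.

(** The probability that [r] consecutive steps all descend: a strictly decreasing sequence of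
    [r + 1] digits is a subset of size [r + 1]. *)
Definition run_prob (R : fieldType) (b r : nat) : R :=
  'C(b, r.+1)%:R / b%:R ^+ r.+1.

(* The value of the bordered determinant whose first row is y |-> k (y - x + d),
   for x followed by the sites marked by w, counted from x + 1. *)
Fixpoint bordered_prob (R : fieldType) (b : nat) (k : nat -> R)
    (w : seq bool) (d : nat) : R :=
  k d * pattern_prob R b w -
  (if w is true :: w' then b%:R^-1 * bordered_prob b k w' d.+1 else 0).

Lemma pattern_prob_false (R : fieldType) b w :
  b%:R != 0 :> R -> pattern_prob R b (false :: w) = pattern_prob R b w.
Proof.
move=> b0; rewrite /pattern_prob /= sum_nat_const card_ord natrM.
by rewrite [b%:R ^+ _.+2]exprS invfM mulrACA divff // mul1r.
Qed.

Lemma run_prob0 (R : fieldType) b : b%:R != 0 :> R -> run_prob R b 0 = 1.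
Proof. by move=> b0; rewrite /run_prob bin1 expr1 divff. Qed.

(** Summing over the next digit raises the binomial by [sum_bin] and leaves the factor [c]
    untouched. *)
Lemma chains_run {R : fieldType} {b w r} {c : R} :
  (forall x, (chains b w x)%:R / b%:R ^+ size w = 'C(x, r)%:R / b%:R ^+ r * c) ->
  forall x, (chains b (true :: w) x)%:R / b%:R ^+ (size w).+1 =
            'C(x, r.+1)%:R / b%:R ^+ r.+1 * c.
Proof.
move=> Hw x; rewrite /= -sum_bin !natr_sum !mulr_suml; apply: eq_bigr => y _.
by rewrite !exprSr !invfM !mulrA Hw; ring.
Qed.

(* Here r is the length of the initial run of w, and c is the probability of what
   follows that run. *)
Lemma bordered_prob_run {R : fieldType} (b : nat) (k : nat -> R) w :
  b%:R != 0 :> R ->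
  exists r (c : R),
    (forall x, (chains b w x)%:R / b%:R ^+ size w = 'C(x, r)%:R / b%:R ^+ r * c) /\
    forall d, bordered_prob b k w d =
      c * \sum_(j < r.+1) (- b%:R^-1) ^+ j * k (d + j)%N * run_prob R b (r - j).
Proof.
move=> b0; elim: w => [|[] w [r [c [Hw IHw]]]].
- exists 0%N, 1; split=> [x|d]; first by rewrite bin0 mulr1.
  rewrite big_ord1 /= run_prob0 // addn0 subr0 /pattern_prob /=.
  by rewrite sum_nat_const card_ord muln1 expr1 divff // expr0; ring.
- exists r.+1, c; split=> [|d]; first exact: chains_run.
  rewrite big_ord_recl /= IHw addn0 subn0 expr0 mul1r mulrDr.
  (* A fictitious initial digit [b] descends to every digit, so [pattern_prob] is a normalised value
     of [chains] at [b]. *)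
  have /(_ b) Hp := chains_run (chains_run Hw).
  rewrite {1}/pattern_prob [X in k d * X]Hp.
  congr (_ + _); first by rewrite /run_prob; ring.
  rewrite !mulr_sumr -sumrN; apply: eq_bigr => j _.
  by rewrite /bump /= add1n subSS exprS addSnnS; ring.
(* After an unconstrained step the count no longer depends on [x]: the run is empty. *)
- exists 0%N, (pattern_prob R b w); split=> [x|d].
    by rewrite bin0 expr0 divr1 mul1r.
  rewrite big_ord1 /= run_prob0 // pattern_prob_false // addn0 expr0; ring.
Qed.

(** * Minors of the kernel as descent probabilities *)

Section Kernel.

Variables (R : fieldType) (b : nat) (k : int -> R).
Hypothesis b0 : b%:R != 0 :> R.
Hypothesis k_lt : forall m : int, m < -1 -> k m = 0.
Hypothesis k_N1 : k (-1) = b%:R^-1.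
Hypothesis k_run : forall r, run_prob R b r.+1 =
  \sum_(j < r.+1) (- b%:R^-1) ^+ j * k j%:Z * run_prob R b (r - j).

(** At [d = 0] the sum over the initial run is the right side of [k_run], which lengthens that run
    by one. *)
Lemma bordered_prob0 w :
  bordered_prob b (fun d => k d%:Z) w 0 = pattern_prob R b (true :: w).
Proof.
have [r [c [Hw ->]]] := bordered_prob_run (fun d => k d%:Z) w b0.
have /(_ b) Hp := chains_run (chains_run Hw).
by rewrite [RHS]Hp mulrC -[_ / _]/(run_prob R b r.+1) k_run.
Qed.

Let K (x y : nat) : R := k (y%:Z - x%:Z).

(** Joint induction: a marked site leads to a longer bordered determinant, a gap to a kernel minor.
    The shift [d] is the distance from the site that gave the first row to the current head [x]. *)
Lemma bordered_detE w :
  (forall x, kernel_det K (mask w (iota x (size w))) = pattern_prob R b w) /\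
  forall x d, bordered_det K (fun y => k (y%:Z - x%:Z + d%:Z))
     (x :: mask w (iota x.+1 (size w))) =
   bordered_prob b (fun d => k d%:Z) w d.
Proof.
elim: w => [|[] w [IH1 IH2]].
- have p1 : pattern_prob R b [::] = 1.
    by rewrite /pattern_prob /= sum_nat_const card_ord muln1 expr1 divff.
  split=> [x|x d]; first by rewrite p1; exact: det_mx00.
  by rewrite bordered_det1 /= p1 subrr add0r mulr1 subr0.
- have D x : bordered_det K (K x) (x :: mask w (iota x.+1 (size w))) =
    pattern_prob R b (true :: w).
    rewrite -bordered_prob0 -(IH2 x); apply: eq_bordered_det => y.
    by rewrite addr0.
  split=> [x|x d]; first by rewrite -(D x) bordered_det_kernel.
  rewrite /= bordered_det_cons => [|z /mem_mask]; last first.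
    by rewrite mem_iota => Hz; apply: k_lt; lia.
  rewrite (D x.+1) subrr add0r; congr (_ - _ * _).
    by rewrite -k_N1; congr k; lia.
  rewrite -(IH2 x.+1); apply: eq_bordered_det => y; congr k; lia.
- split=> [x|x d]; first by rewrite pattern_prob_false //= -(IH1 x.+1).
  rewrite /= pattern_prob_false // subr0 -(IH1 x.+2).
  (* Beyond the gap, the next site [y] is at least [x + 2], so the subdiagonal entry vanishes too
     and the determinant factors. *)
  case E : (mask _ _) => [|y s].
    by rewrite bordered_det1 [kernel_det _ _]det_mx00 subrr add0r mulr1.
  have Hm z : z \in y :: s -> (x.+1 < z)%N.
    by rewrite -E => /mem_mask; rewrite mem_iota => /andP[].
  rewrite bordered_det_cons => [|z zs]; last first.
    by apply: k_lt; have := Hm z; rewrite inE zs orbT => /(_ isT); lia.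
  rewrite bordered_det_kernel subrr add0r [K y x]k_lt ?mul0r ?subr0 //.
  by have := Hm y (mem_head _ _); lia.
Qed.
End Kernel.

(** * Coefficients of the Laurent expansion *)

Definition descent_denom (R : nzRingType) (b : nat) : {poly R} :=
  1 - (1 - 'X) ^+ b.

Lemma coef_descent_denom (R : comNzRingType) b s :
  (descent_denom R b)`_s = (- (-1) ^+ s * 'C(b, s)%:R) *+ (0 < s).
Proof.
rewrite /descent_denom coefB coef1.
have -> : (1 - 'X) ^+ b = \poly_(i < b.+1) ((-1) ^+ i * 'C(b, i)%:R) :> {poly R}.
  rewrite poly_def exprBn; apply: eq_bigr => i _.
  rewrite expr1n mulr1 -mul_polyC rmorphM rmorphXn rmorphN1 rmorph_nat.
  by rewrite -mulr_natr mulrAC.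
rewrite coef_poly ltnS.
case: s => [|s]; first by rewrite expr0 bin0 mulr1 subrr mulr0n.
rewrite sub0r mulr1n mulNr; case: ltnP => // bs.
by rewrite bin_small // mulr0.
Qed.

Section Laurent.
Variables (R : realFieldType) (b : nat) (k : int -> R).
Hypothesis b2 : (2 <= b)%N.
Hypothesis hk : laurent_expansion (1 / (1 - (1 - ('X : {poly R})%:F) ^+ b)) k.

Lemma mul_poly_series_widen (q : {poly R}) M m : (size q <= M)%N ->
  mul_poly_series q k m = \sum_(i < M) q`_i * k (m - i%:Z).
Proof.
move=> qM; rewrite /mul_poly_series.
rewrite (big_ord_widen _ (fun i : nat => q`_i * k (m - i%:Z)) qM) big_mkcond /=.
apply: eq_bigr => i _; case: ltnP => // /(nth_default 0) ->.
by rewrite mul0r.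
Qed.

(* Only finitely many terms are nonzero, but before laurent_lt there is no explicit
   bound on their number. *)
Lemma descent_recurrence m : exists M0, forall M, (M0 <= M)%N ->
  \sum_(i < M) (-1) ^+ i * 'C(b, i.+1)%:R * k (m - i%:Z) = (m == -1)%:R.
Proof.
case: hk => _ Hk; exists (size (descent_denom R b)) => M hM.
have d1 : (descent_denom R b)`_1 != 0.
  by rewrite coef_descent_denom bin1 expr1 opprK mul1r pnatr_eq0; lia.
have d0 : descent_denom R b != 0 by apply: contraNneq d1 => ->; rewrite coef0.
have /(Hk 1 _ d0)/(_ (m + 1)) :
    1 / (1 - (1 - ('X : {poly R})%:F) ^+ b) = 1%:F / (descent_denom R b)%:F.
  by rewrite /descent_denom !(rmorphB, rmorphXn, rmorph1).
(* The denominator has no constant term; dropping it explains [M.+1] and the evaluation at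
   [m + 1]. *)
rewrite (@mul_poly_series_widen _ M.+1) ?(leqW hM) // big_ord_recl.
rewrite coef_descent_denom mul0r add0r => E.
transitivity (poly_series (1 : {poly R}) (m + 1)).
  rewrite -E; apply: eq_bigr => i _; rewrite coef_descent_denom lift0 /= mulr1n.
  rewrite exprS mulN1r opprK; congr (_ * k _); lia.
rewrite /poly_series; case Em : (m + 1) => [i|i].
  by rewrite coef1; congr (_%:R); lia.
by rewrite (_ : (m == -1) = false) //; lia.
Qed.

(** Induction upward from the unknown bound [N]: in the recurrence at [m] only the term [b%:R * k m]
    survives. *)
Lemma laurent_lt m : m < -1 -> k m = 0.
Proof.
have b0 : b%:R != 0 :> R by rewrite pnatr_eq0; lia.
case: hk => -[N HN] _.
have H (j : nat) : forall m : int, m < N + j%:Z -> m < -1 -> k m = 0.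
  elim: j => [|j IH] {}m mN m1; first by apply: HN; lia.
  have [M0 /(_ M0.+1 (leqnSn _))] := descent_recurrence m.
  rewrite big_ord_recl big1 => [|i _].
    rewrite addr0 expr0 mul1r bin1 subr0 (lt_eqF m1) => /eqP.
    by rewrite mulf_eq0 (negPf b0) => /eqP.
  by rewrite IH ?mulr0 // lift0; lia.
by move=> m1; apply: (H `|m - N|.+1) => //; lia.
Qed.

Lemma laurent_recurrence m :
  \sum_(i < m.+1) (-1) ^+ i * 'C(b, i.+1)%:R * k (m%:Z - 1 - i%:Z) = (m == 0%N)%:R.
Proof.
have [M0 /(_ _ (leq_maxl M0 m.+1))] := descent_recurrence (m%:Z - 1).
have -> : (m%:Z - 1 == -1 :> int) = (m == 0%N) by lia.
move <-; pose F (i : nat) := (-1) ^+ i * 'C(b, i.+1)%:R * k (m%:Z - 1 - i%:Z).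
rewrite (big_ord_widen _ F (leq_maxr M0 m.+1)) big_mkcond.
apply: eq_bigr => i _; case: ltnP => // mi.
by rewrite laurent_lt ?mulr0 //; lia.
Qed.

Lemma laurent_N1 : k (-1) = b%:R^-1.
Proof.
have b0 : b%:R != 0 :> R by rewrite pnatr_eq0; lia.
have := laurent_recurrence 0; rewrite big_ord1 expr0 mul1r bin1.
by move=> /(canRL (mulKf b0)); rewrite mulr1.
Qed.

(** In the recurrence at [r + 1], whose right side is 0, the last term carries [k (-1)] and
    ['C(b, r.+2)]; it is isolated and the remaining sum reversed. *)
Lemma laurent_run r : run_prob R b r.+1 =
  \sum_(j < r.+1) (- b%:R^-1) ^+ j * k j%:Z * run_prob R b (r - j).
Proof.
have b0 : b%:R != 0 :> R by rewrite pnatr_eq0; lia.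
have := laurent_recurrence r.+1; rewrite big_ord_recr /=.
rewrite (reindex_inj rev_ord_inj) /= [in k _](_ : _ - _ = -1); last by lia.
rewrite laurent_N1 => /eqP; rewrite addrC addr_eq0 => /eqP E.
(* Powers of [b] and signs are cleared, then generalised to atoms for [field]. *)
apply: (mulfI (expf_neq0 r.+1 b0)).
have sg : (-1) ^+ r.+1 != 0 :> R by rewrite signr_eq0.
apply: (mulfI sg).
rewrite /run_prob.
transitivity ((-1) ^+ r.+1 * 'C(b, r.+2)%:R / b%:R : R).
  rewrite [b%:R ^+ r.+2]exprS; move: (expf_neq0 r.+1 b0).
  by move: (b%:R ^+ r.+1) ((-1) ^+ r.+1) => B s B0; field; rewrite ?b0 ?B0.
rewrite E -sumrN !mulr_sumr; apply: eq_bigr => j _.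
have -> : r.+1%:Z - 1 - (r.+1 - j.+1)%N%:Z = j%:Z.
  by have := ltn_ord j; lia.
rewrite !subSS.
rewrite [(- b%:R^-1) ^+ j]exprNn exprVn.
have -> : (-1) ^+ r.+1 = - (-1) ^+ (r - j) * (-1) ^+ j :> R.
  by rewrite exprS mulN1r mulNr -exprD subnK // -ltnS.
have -> : b%:R ^+ r.+1 = b%:R ^+ (r - j).+1 * b%:R ^+ j :> R.
  by rewrite -exprD addSn subnK // -ltnS.
have : (-1) ^+ j * (-1) ^+ j = 1 :> R by rewrite -expr2 sqrr_sign.
move: (expf_neq0 (r - j).+1 b0) (expf_neq0 j b0).
move: (_ ^+ (r - j).+1) (_%:R ^+ j) ((-1) ^+ j) => B B' s B0 B'0 s2.
transitivity (- ((-1) ^+ (r - j) * (s * s) * 'C(b, (r - j).+1)%:R * k j)).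
  by rewrite s2; ring.
by field; rewrite ?B0 ?B'0 ?b0.
Qed.
End Laurent.

(** * Counting digit sequences with prescribed descents *)

Definition ffun_cons (T : finType) m (x : T) (f : {ffun 'I_m -> T}) :
    {ffun 'I_m.+1 -> T} :=
  [ffun i => if unlift ord0 i is Some j then f j else x].

Lemma ffun_cons0 (T : finType) m (x : T) (f : {ffun 'I_m -> T}) :
  ffun_cons x f ord0 = x.
Proof. by rewrite ffunE unlift_none. Qed.

Lemma ffun_consS (T : finType) m (x : T) (f : {ffun 'I_m -> T}) i :
  ffun_cons x f (lift ord0 i) = f i.
Proof. by rewrite ffunE liftK. Qed.

Lemma sum_ffun_cons (T : finType) m (F : {ffun 'I_m.+1 -> T} -> nat) :
  (\sum_f F f = \sum_(x : T) \sum_(f : {ffun 'I_m -> T}) F (ffun_cons x f))%N.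
Proof.
rewrite pair_big /= (reindex (fun p => ffun_cons p.1 p.2)) //=.
exists (fun f => (f ord0, [ffun i => f (lift ord0 i)])) => [[x f] _|f _] /=.
  by rewrite ffun_cons0; congr (_, _); apply/ffunP => i; rewrite ffunE ffun_consS.
apply/ffunP => i; rewrite ffunE; case: unliftP => [j ->|->] //.
by rewrite ffunE.
Qed.

(** With [A] a predicate on [nat], removing the first digit merely shifts it to [A \o S]. *)
Definition descends_on (b m : nat) (A : pred nat) (f : {ffun 'I_m.+1 -> 'I_b}) :=
  [forall i : 'I_m, A i ==> (f (lift ord0 i) < f (widen_ord (leqnSn m) i))%N].

Lemma descends_on_cons b m A x (f : {ffun 'I_m.+1 -> 'I_b}) :
  descends_on A (ffun_cons x f) =
  (A 0%N ==> (f ord0 < x)%N) && descends_on (A \o S) f.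
Proof.
have W0 : widen_ord (leqnSn m.+1) ord0 = ord0 by apply: val_inj.
have WS (i : 'I_m) : widen_ord (leqnSn m.+1) (lift ord0 i) =
    lift ord0 (widen_ord (leqnSn m) i) by apply: val_inj.
apply/forallP/andP => [H|[H0 /forallP H] i].
  split; first by have := H ord0; rewrite W0 ffun_consS ffun_cons0.
  by apply/forallP => i; have := H (lift ord0 i); rewrite WS !ffun_consS.
case: (unliftP ord0 i) => [j ->|->]; last by rewrite W0 ffun_consS ffun_cons0.
by rewrite WS !ffun_consS; exact: H.
Qed.

Lemma count_descends_on b m A (x : 'I_b) :
  (\sum_(f : {ffun 'I_m -> 'I_b}) descends_on A (ffun_cons x f) =
   chains b (mkseq A m) x)%N.
Proof.
elim: m A x => [|m IHm] A x.
  rewrite (eq_bigr (fun=> 1%N)) => [|f _]; last first.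
    by rewrite (_ : descends_on _ _) //; apply/forallP => -[].
  by rewrite sum1_card card_ffun !card_ord.
rewrite sum_ffun_cons /mkseq /= (iotaDl 1 0) -map_comp.
transitivity (\sum_(y < b | A 0%N ==> (y < x)%N) chains b (mkseq (A \o S) m) y)%N.
  rewrite [RHS]big_mkcond; apply: eq_bigr => y _; rewrite -IHm.
  case: ifP => Ay; last rewrite big1 // => f _.
    by apply: eq_bigr => f _; rewrite descends_on_cons ffun_cons0 Ay.
  by rewrite descends_on_cons ffun_cons0 Ay.
case: (A 0%N) => //=; symmetry.
exact: (big_ord_widen _ (chains b (mkseq (A \o S) m)) (ltnW (ltn_ord x))).
Qed.

Lemma sum_descends_on b m A :
  (\sum_(f : {ffun 'I_m.+1 -> 'I_b}) descends_on A f =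
   \sum_(x < b) chains b (mkseq A m) x)%N.
Proof.
by rewrite sum_ffun_cons; apply: eq_bigr => x _; exact: count_descends_on.
Qed.

(** * Laws of random sets built from uniform digits *)

Section Law.
Variables (R : realFieldType) (b n : nat).

Lemma law_point_process (X : finType) (F : digits b n -> {set X}) :
  (0 < b)%N -> is_point_process (law_of_digits R F).
Proof.
move=> b0; split=> [S|].
  by apply: sumr_ge0 => a _; apply: prodr_ge0 => i _; rewrite invr_ge0 ler0n.
transitivity (\sum_(a : digits b n) \prod_(i < n) (b%:R)^-1 : R).
  by rewrite (partition_big F xpredT).
rewrite prodr_const sumr_const card_ffun !card_ord.
by rewrite -[LHS]mulr_natr natrX exprVn mulVf // expf_neq0 // pnatr_eq0 -lt0n.
Qed.

Lemma law_superset (X : finType) (F : digits b n -> {set X}) (A : {set X}) :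
  \sum_(S : {set X} | A \subset S) law_of_digits R F S =
  (\sum_a (A \subset F a))%N%:R / b%:R ^+ n.
Proof.
transitivity (\sum_(a | A \subset F a) (b%:R^-1) ^+ n : R).
  rewrite (partition_big F (fun S => A \subset S)) //=.
  apply: eq_bigr => S AS; apply: eq_big => [a|a _].
    by case: eqP => [->|]; rewrite ?AS ?andbF.
  by rewrite prodr_const card_ord.
rewrite natr_sum mulr_suml big_mkcond exprVn; apply: eq_bigr => a _.
by case: ifP; rewrite ?mul1r ?mul0r.
Qed.
End Law.

Lemma descents_superset b m (A : {set 'I_m}) (a : digits b m.+1) :
  (A \subset descents a) = descends_on (mem [seq val i | i in A]) a.
Proof.
apply/subsetP/forallP => [H i|H i iA].
  apply/implyP => /mapP[j]; rewrite mem_enum => jA /val_inj ->.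
  have := H j jA; rewrite inE /site /succ_site.
  have -> : Ordinal (etrans (esym (ltn_predRL j m.+1)) (ltn_ord j)) = lift ord0 j.
    by apply: val_inj.
  by rewrite (_ : widen_ord _ _ = widen_ord (leqnSn m) j) //; exact: val_inj.
have := H i; rewrite inE /=  map_f ?mem_enum //=.
rewrite inE; congr (a _ < a _)%N; exact: val_inj.
Qed.

(** * Remainders, from carries to descents *)

Lemma remainder_succ b n (a : digits b n) (i : 'I_n.-1) :
  remainder a (succ_site i) = ((remainder a (site i) + a (succ_site i)) %% b)%N.
Proof.
rewrite /remainder (bigD1 (succ_site i)) //= addnC modnDml; congr ((_ + _) %% b)%N.
apply: eq_bigl => j; rewrite -val_eqE /=; lia.
Qed.

Lemma remainder0 b m (a : digits b m.+1) : remainder a ord0 = a ord0.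
Proof.
rewrite /remainder (big_pred1 ord0) ?modn_small // => j.
by rewrite leqn0.
Qed.

Section Remainders.
Variables (b m : nat).
Hypothesis b_gt0 : (0 < b)%N.

Definition remainders (a : digits b m.+1) : digits b m.+1 :=
  [ffun i : 'I_m.+1 => Ordinal (ltn_pmod (\sum_(j < m.+1 | (j <= i)%N) a j)%N b_gt0)].

Lemma remaindersE a i : remainders a i = remainder a i :> nat.
Proof. by rewrite ffunE. Qed.

(** The first remainder is the first digit, and each later digit is a difference mod [b] of
    successive remainders. *)
Lemma remainders_inj : injective remainders.
Proof.
move=> a a' /ffunP E.
have {}E i : remainder a i = remainder a' i by rewrite -!remaindersE E.
apply/ffunP => -[]; case=> [|i] Hi.
  apply: val_inj; have := E ord0; rewrite !remainder0.
  by rewrite (_ : Ordinal Hi = ord0) //; exact: val_inj.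
have [j ->] : exists j : 'I_m.+1.-1, Ordinal Hi = succ_site j.
  by exists (Ordinal (Hi : (i < m.+1.-1)%N)); apply: val_inj.
apply: val_inj; have := E (succ_site j); rewrite !remainder_succ E.
move/eqP; rewrite eqn_modDl !modn_small // => /eqP //.
Qed.

(** Adding [v < b] to [u] lowers the remainder by [b - v > 0] if there is a carry, and otherwise
    raises it by [v]. *)
Lemma carries_descents a : carries a = descents (remainders a).
Proof.
apply/setP => i; rewrite !inE !remaindersE remainder_succ.
set u := remainder _ _; set v := a _.
have ub : (u < b)%N by rewrite ltn_mod.
have vb : (v < b)%N := ltn_ord v.
case: (ltnP (u + v) b) => uvb; first by rewrite modn_small //; lia.
by rewrite -(subnK uvb) modnDr modn_small; lia.
Qed.

Lemma carry_process_descent (R : realFieldType) :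
  carry_process R b m.+1 =1 descent_process R b m.+1.
Proof.
move=> S; rewrite /carry_process /descent_process /law_of_digits.
(* An injective self-map of a finite set is a bijection, and all digit sequences have equal
   weight. *)
rewrite [RHS](reindex_inj remainders_inj); apply: eq_bigl => a.
by rewrite carries_descents.
Qed.
End Remainders.

(** * Correlation functions as kernel minors *)

Lemma det_enum_val (R : comNzRingType) m (A : {set 'I_m}) (K : nat -> nat -> R) :
  \det (\matrix_(i < #|A|, j < #|A|) K (enum_val i) (enum_val j)) =
  kernel_det K (mask (mkseq (mem [seq val i | i in A]) m) (iota 0 m)).
Proof.
have -> : mask (mkseq (mem [seq val i | i in A]) m) (iota 0 m) =
    [seq val i | i <- enum A].
  rewrite -filter_mask -val_enum_ord filter_map {2}/enum_mem -enumT.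
  congr (map _ _); apply: eq_filter => i /=.
  by rewrite mem_map ?mem_enum //; exact: val_inj.
rewrite /kernel_det size_map -cardE; congr (\det _); apply/matrixP => i j; rewrite !mxE.
by rewrite !(nth_map (enum_default i)) -?cardE // !(enum_val_nth (enum_default i)).
Qed.

Theorem theorem3p1 (R : realFieldType) (b n : nat) (hb : (2 <= b)%N)
    (hn : (2 <= n)%N) (k : int -> R)
    (hk : laurent_expansion (1 / (1 - (1 - ('X : {poly R})%:F) ^+ b)) k) :
  let K := fun i j : 'I_n.-1 => k (j%:Z - i%:Z) in
  determinantal (carry_process R b n) K /\
  determinantal (descent_process R b n) K.
Proof.
case: n hn => // m _ K.
have b_gt0 : (0 < b)%N := ltnW hb.
have b0 : b%:R != 0 :> R by rewrite pnatr_eq0 -lt0n.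
have Hd : determinantal (descent_process R b m.+1) K.
  split=> [|A]; first exact: law_point_process.
  rewrite law_superset.
  rewrite (eq_bigr _ (fun a _ => congr1 nat_of_bool (descents_superset A a))).
  rewrite sum_descends_on (det_enum_val _ (fun x y => k (y%:Z - x%:Z))).
  have [H _] := bordered_detE b0 (laurent_lt hb hk)
    (laurent_N1 hb hk) (laurent_run hb hk)
    (mkseq (mem [seq val i | i in A]) m).
  by have := H 0%N; rewrite size_mkseq => ->; rewrite /pattern_prob size_mkseq.
split=> //; case: Hd => _ Hd; split=> [|A]; first exact: law_point_process.
by rewrite -Hd; apply: eq_bigr => S _; exact: carry_process_descent.
Qed.
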